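(* In the setting described in the context, assume that $\mathcal{H}+\mathcal{V}$ has constant rank on $M$. Let $\xi^{\mathcal{H}}$ be a smooth section of $\mathfrak{g}^{\mathcal{H}}$, let $h\in C^\infty(M)$ be a $G$-invariant Hamiltonian, and let $X_h\in\Gamma(\mathcal{H})$ be the solution of the implicit Hamiltonian system $(X_h,\mathbf{d}h)\in\Gamma(D)$. Then $X_h$ satisfies the Nonholonomic Noether Momentum Equation $$\mathbf{d}\mathbf{J}^{\xi^{\mathcal{H}}}(X_h)-\mathbf{J}^{X_h[\xi^{\mathcal{H}}]}=0 .$$
   Context: Nonholonomic system. $Q$ is a smooth Riemannian manifold, $L:TQ\to\mathbb{R}$ is the kinetic energy of the metric minus a potential, $\mathbb{F}L:TQ\to T^*Q$ its Legendre transformation (a diffeomorphism). $\phi^1,\dots,\phi^k$ are pointwise linearly independent $1$-forms on $Q$, $\mathcal{D}=\bigcap_j\ker\phi^j\subset TQ$, and $M:=\mathbb{F}L(\mathcal{D})\subset T^*Q$ with inclusion $i$. With $\omega_{\rm can}=\sum dq^i\wedge dp_i$ and $\pi_{T^*Q}:T^*Q\to Q$, set $\omega_M:=i^*\omega_{\rm can}$ and $\mathcal{H}:=TM\cap (T\pi_{T^*Q})^{-1}(\mathcal{D})$. It is known that $\mathcal{H}$ is a vector subbundle of $TM$ and that $\omega_M|_{\mathcal{H}\times\mathcal{H}}$ is nondegenerate. $\Gamma$ denotes smooth local sections, $\mathcal{H}^\circ\subset T^*M$ the annihilator. The associated Dirac structure (not necessarily integrable) $D\subset TM\oplus T^*M$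 is the subbundle whose sections are the pairs $(X,\alpha)$ with $X\in\Gamma(\mathcal{H})$ and $\alpha-\mathbf{i}_X\omega_M\in\Gamma(\mathcal{H}^\circ)$. For each $h\in C^\infty(M)$ there is a unique $X_h\in\Gamma(\mathcal{H})$ with $(X_h,\mathbf{d}h)\in\Gamma(D)$. Symmetry. A Lie group $G$ with Lie algebra $\mathfrak{g}$ acts on $Q$ leaving $\mathcal{D}$ and $L$ invariant. The cotangent lifted action on $T^*Q$ then leaves $M$ invariant, and the induced action on $M$ is assumed free and proper. $\xi_Q,\xi_M$ denote the infinitesimal generators of $\xi\in\mathfrak{g}$ on $Q$, $M$, and $\mathcal{V}\subset TM$ is the subbundle with fibers $\mathcal{V}(m)=\{\xi_M(m)\mid\xi\in\mathfrak{g}\}$. Momentum map. $\mathbf{J}:T^*Q\to\mathfrak{g}^*$ is $\mathbf{J}(p)(\xi)=\langle p,\xi_Q(\pi_{T^*Q}(p))\rangle$, and $\mathbf{J}^\xi(p)=\mathbf{J}(p)(\xi)$; the same symbols denote restrictions to $M$. For $p\in M$ let $\mathfrak{g}^p:=\{\xi\in\mathfrak{g}\mid\xi_M(p)\in(\mathcal{V}\cap\mathcal{H})(p)\}$ and $\mathfrak{g}^{\mathcal{H}}:=\bigcup_{p\in M}\mathfrak{g}^p$; if $\mathcal{H}+\mathcal{V}$ has constant rank, this is a vector subbundle of the trivial bundle $M\times\mathfrak{g}$. Fix a basis $\xi^1,\dots,\xi^d$ of $\mathfrak{g}$. For a smooth section $\xi^{\mathcal{H}}=\sum_i f_i\xi^i$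 of $\mathfrak{g}^{\mathcal{H}}$ ($f_i$ smooth functions on $M$) define the function $\mathbf{J}^{\xi^{\mathcal{H}}}(p):=\langle\mathbf{J}(p),\xi^{\mathcal{H}}(p)\rangle=\sum_i f_i(p)\mathbf{J}^{\xi^i}(p)$ and, for a vector field $X$ on $M$, $X[\xi^{\mathcal{H}}]:=\sum_i X[f_i]\,\xi^i$ (a $\mathfrak{g}$-valued function) and $\mathbf{J}^{X[\xi^{\mathcal{H}}]}:=\sum_i X[f_i]\,\mathbf{J}^{\xi^i}$. *)

(* Defs.v *)
From HB Require Import structures.
From mathcomp Require Import all_boot all_order all_algebra.
From mathcomp Require Import all_classical all_reals all_analysis.
Import Order.TTheory GRing.Theory Num.Theory.
Import numFieldNormedType.Exports.

Set Implicit Arguments.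
Unset Strict Implicit.
Unset Printing Implicit Defensive.

Local Open Scope classical_set_scope.
Local Open Scope ring_scope.


Section Smoothness.
Context {R : realType} {V W : normedModType R}.

(* f is of class C^k on the open set A *)
Fixpoint Ck (k : nat) (A : set V) (f : V -> W) : Prop :=
  match k with
  | 0 => forall x, A x -> {for x, continuous f}
  | k'.+1 => (forall x, A x -> differentiable f x) /\
             (forall v, Ck k' A (fun x => 'D_v f x))
  end.

Definition Cinf (A : set V) (f : V -> W) : Prop := forall k, Ck k A f.

End Smoothness.


(* cinv is the inverse of the bijection cmap : cdom -> ccod; the values of cmap
   outside cdom and of cinv outside ccod are irrelevant. *)
Record chart (R : realType) (n : nat) (T : Type) := Chart {
  cdom : set T;
  ccod : set 'rV[R]_n;
  cmap : T -> 'rV[R]_n;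
  cinv : 'rV[R]_n -> T }.

(* An atlas is indexed by the points of the space, with chart_at x a preferred
   chart around x.  This is only data: it describes Q and M, but also the
   bundles TQ, T^*Q, and products. *)
Record charted (R : realType) (n : nat) := Charted {
  charted_point :> Type;
  chart_at : charted_point -> chart R n charted_point }.

Record manifold (R : realType) (n : nat) := Manifold {
  mpoint :> topologicalType;
  mchart_at : mpoint -> chart R n mpoint;
  manifold_hausdorff : hausdorff_space mpoint;
  manifold_countable : @second_countable mpoint;
  mem_cdom : forall x, cdom (mchart_at x) x;
  open_cdom : forall x, open (cdom (mchart_at x));
  open_ccod : forall x, open (ccod (mchart_at x));
  cmap_cod : forall x y, cdom (mchart_at x) y ->
    ccod (mchart_at x) (cmap (mchart_at x) y);
  cinv_dom : forall x u, ccod (mchart_at x) u ->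
    cdom (mchart_at x) (cinv (mchart_at x) u);
  cmapK : forall x y, cdom (mchart_at x) y ->
    cinv (mchart_at x) (cmap (mchart_at x) y) = y;
  cinvK : forall x u, ccod (mchart_at x) u ->
    cmap (mchart_at x) (cinv (mchart_at x) u) = u;
  cmap_continuous : forall x y, cdom (mchart_at x) y ->
    {for y, continuous (cmap (mchart_at x))};
  cinv_continuous : forall x u, ccod (mchart_at x) u ->
    {for u, continuous (cinv (mchart_at x))};
  transition_smooth : forall x y,
    Cinf [set u | ccod (mchart_at x) u /\
                  cdom (mchart_at y) (cinv (mchart_at x) u)]
         (cmap (mchart_at y) \o cinv (mchart_at x)) }.

Coercion manifold_charted (R : realType) (n : nat) (X : manifold R n) :
  charted R n := Charted (@mchart_at R n X).

(* A tangent vector at x is represented by the row vector of its components in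
   the preferred chart chart_at x, and a covector by the row vector of its
   components in the dual basis. *)

Section Calculus.
Context {R : realType}.

Definition transition n (X : charted R n) (x y : X) : 'rV[R]_n -> 'rV[R]_n :=
  cmap (chart_at y) \o cinv (chart_at x).

Definition base n (X : charted R n) (x : X) : 'rV[R]_n := cmap (chart_at x) x.

Definition pairing n (p v : 'rV[R]_n) : R := (p *m v^T) 0 0.

(* the covector of a linear form l *)
Definition covec n (l : 'rV[R]_n -> R) : 'rV[R]_n := \row_j l (delta_mx 0 j).

(* the topology induced by the atlas *)
Definition atlas_open n (X : charted R n) (A : set X) : Prop :=
  forall x : X,
    open [set u | ccod (chart_at x) u /\ A (cinv (chart_at x) u)].

(* f is smooth on the open set A.  The requirement that the coordinate domains
   be open expresses the continuity of f. *)
Definition smooth_map n m (X : charted R n) (Y : charted R m)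
    (A : set X) (f : X -> Y) : Prop :=
  forall (x : X) (y : Y),
    let B := [set u | [/\ ccod (chart_at x) u, A (cinv (chart_at x) u)
                        & cdom (chart_at y) (f (cinv (chart_at x) u))]] in
    open B /\ Cinf B (cmap (chart_at y) \o f \o cinv (chart_at x)).

Definition smooth_fun n (X : charted R n) (A : set X) (f : X -> R) : Prop :=
  forall x : X,
    Cinf [set u | ccod (chart_at x) u /\ A (cinv (chart_at x) u)]
         (f \o cinv (chart_at x) : 'rV[R]_n -> R^o).

(* the tangent map T_x f : T_x X -> T_(f x) Y *)
Definition tangent_map n m (X : charted R n) (Y : charted R m) (f : X -> Y)
    (x : X) : 'rV[R]_n -> 'rV[R]_m :=
  'd (cmap (chart_at (f x)) \o f \o cinv (chart_at x)) (base x).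

Definition dfun n (X : charted R n) (f : X -> R) (x : X) : 'rV[R]_n -> R :=
  'd (f \o cinv (chart_at x) : 'rV[R]_n -> R^o) (base x).

Definition prod_charted n m (X : charted R n) (Y : charted R m) :
    charted R (n + m) :=
  Charted (fun a : X * Y =>
    let c := chart_at a.1 in let c' := chart_at a.2 in
    Chart [set b | cdom c b.1 /\ cdom c' b.2]
          [set u | ccod c (lsubmx u) /\ ccod c' (rsubmx u)]
          (fun b => row_mx (cmap c b.1) (cmap c' b.2))
          (fun u => (cinv c (lsubmx u), cinv c' (rsubmx u)))).

(* Charts (x, v) of TX: the vector at y with components w in chart_at y has
   components 'd (transition y x) w in chart_at x. *)
Definition tangent_bundle n (X : charted R n) : charted R (n + n) :=
  Charted (fun a : X * 'rV[R]_n =>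
    let c := chart_at a.1 in
    Chart [set b | cdom c b.1]
          [set u | ccod c (lsubmx u)]
          (fun b => row_mx (cmap c b.1)
             ('d (transition b.1 a.1) (base b.1) b.2))
          (fun u => let y := cinv c (lsubmx u) in
             (y, 'd (transition a.1 y) (lsubmx u) (rsubmx u)))).

(* The canonical charts (q^i, p_i) of T^*X: the components of covectors change
   by transposition, i.e. p at y has components p \o 'd (transition x y) in
   chart_at x. *)
Definition cotangent_bundle n (X : charted R n) : charted R (n + n) :=
  Charted (fun a : X * 'rV[R]_n =>
    let c := chart_at a.1 in
    Chart [set b | cdom c b.1]
          [set u | ccod c (lsubmx u)]
          (fun b => row_mx (cmap c b.1)
             (covec (fun w =>
                pairing b.2 ('d (transition a.1 b.1) (cmap c b.1) w))))
          (fun u => let y := cinv c (lsubmx u) in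
             (y, covec (fun w =>
                pairing (rsubmx u) ('d (transition y a.1) (base y) w))))).

Definition smooth_vector_field n (X : charted R n) (A : set X)
    (v : X -> 'rV[R]_n) : Prop :=
  smooth_map (X := X) (Y := tangent_bundle X) A (fun x => (x, v x)).

Definition smooth_one_form n (X : charted R n) (A : set X)
    (s : X -> 'rV[R]_n) : Prop :=
  smooth_map (X := X) (Y := cotangent_bundle X) A (fun x => (x, s x)).

Definition bundle_proj n (X : charted R n) : cotangent_bundle X -> X := fst.

(* sum_i dq^i /\ dp_i on T_a(T^*X), in the canonical chart preferred at a *)
Definition omega_can n (X : charted R n) (a : cotangent_bundle X)
    (u v : 'rV[R]_(n + n)) : R :=
  \sum_(i < n) (lsubmx u 0 i * rsubmx v 0 i - rsubmx u 0 i * lsubmx v 0 i).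

Definition embedding n m (X : manifold R n) (Y : charted R m) (f : X -> Y) :
    Prop :=
  [/\ smooth_map (X := X) setT f,
      injective f,
      forall x, injective (tangent_map (X := X) f x)
    & forall A : set X, open A ->
        exists2 B : set Y, atlas_open B & A = f @^-1` B].

End Calculus.


Definition metric_form (R : realType) (n : nat) (g : 'M[R]_n)
  (v w : 'rV[R]_n) : R := (v *m g *m w^T) 0 0.

(* the Gram matrix of g at cinv u in the coordinate frame of chart_at x *)
Definition metric_in_chart (R : realType) n (X : charted R n)
    (g : X -> 'M[R]_n) (x : X) (u : 'rV[R]_n) : 'M[R]_n :=
  let y := cinv (chart_at x) u in
  let frame i := 'd (transition x y) u (delta_mx 0 i) in
  \matrix_(i, j) metric_form (g y) (frame i) (frame j).

Record nonholonomic_system (R : realType) (n k : nat) := NonholonomicSystem {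
  conf : manifold R n;
  metric : conf -> 'M[R]_n;
  metric_form_sym : forall q v w,
    metric_form (metric q) v w = metric_form (metric q) w v;
  metric_form_pos : forall q v, v != 0 -> 0 < metric_form (metric q) v v;
  metric_smooth : forall q : conf,
    Cinf (ccod (mchart_at q)) (metric_in_chart (X := conf) metric q);
  potential : conf -> R;
  potential_smooth : smooth_fun (X := conf) setT potential;
  constraint : 'I_k -> conf -> 'rV[R]_n;
  constraint_smooth : forall j,
    smooth_one_form (X := conf) setT (constraint j);
  constraint_free : forall q, row_free (\matrix_(j < k) constraint j q) }.

Section Nonholonomic.
Context {R : realType} {n k : nat}.
Context (S : nonholonomic_system R n k).
Let Q := conf S.

Definition lagrangian (a : tangent_bundle Q) : R :=
  2^-1 * metric_form (metric a.1) a.2 a.2 - potential a.1.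

(* the fibre derivative of L *)
Definition legendre (a : tangent_bundle Q) : cotangent_bundle Q :=
  (a.1, covec ('d (fun v : 'rV[R]_n => lagrangian (a.1, v) : R^o) (a.2))).

Definition constraint_space (q : Q) : {vspace 'rV[R]_n} :=
  (\bigcap_(j < k) lker (linfun (pairing (constraint j q) : _ -> R^o)))%VS.

Definition constrained_momenta : set (cotangent_bundle Q) :=
  [set legendre a | a in [set a | a.2 \in constraint_space a.1]].

Context {r : nat}.
Context (M : manifold R r) (i : M -> cotangent_bundle Q).

Definition omegaM (m : M) (v w : 'rV[R]_r) : R :=
  omega_can (i m) (tangent_map (X := M) i m v) (tangent_map (X := M) i m w).

Definition horizontal (m : M) : {vspace 'rV[R]_r} :=
  (linfun (tangent_map (@bundle_proj R n Q) (i m) \o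
           tangent_map (X := M) i m)
     @^-1: constraint_space (bundle_proj (i m)))%VS.

(* smooth local sections, over the open set A, of the horizontal bundle, of its
   annihilator and of the Dirac structure *)
Definition horizontal_section (A : set M) (X : M -> 'rV[R]_r) : Prop :=
  smooth_vector_field (X := M) A X /\ forall m, A m -> X m \in horizontal m.

Definition annihilator_section (A : set M) (s : M -> 'rV[R]_r) : Prop :=
  smooth_one_form (X := M) A s /\
  forall m w, A m -> w \in horizontal m -> pairing (s m) w = 0.

Definition dirac_section (A : set M) (X s : M -> 'rV[R]_r) : Prop :=
  horizontal_section A X /\
  annihilator_section A (fun m => s m - covec (omegaM m (X m))).

End Nonholonomic.

Arguments constrained_momenta {R n k} S _.


Record lie_group (R : realType) (d : nat) := LieGroup {
  group_manifold :> manifold R d;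
  gmul : group_manifold -> group_manifold -> group_manifold;
  gone : group_manifold;
  ginv : group_manifold -> group_manifold;
  gmulA : associative gmul;
  gmul1 : left_id gone gmul;
  gmulV : left_inverse gone ginv gmul;
  gmul_smooth : smooth_map
    (X := prod_charted group_manifold group_manifold) (Y := group_manifold)
    setT (fun a => gmul a.1 a.2);
  ginv_smooth : smooth_map (X := group_manifold) (Y := group_manifold)
    setT ginv }.

Record lie_action (R : realType) (d n : nat) (G : lie_group R d)
    (X : manifold R n) := LieAction {
  lie_act :> G -> X -> X;
  lie_act1 : forall x, lie_act (gone G) x = x;
  lie_actM : forall g h x, lie_act (gmul g h) x = lie_act g (lie_act h x);
  lie_act_smooth : smooth_map (X := prod_charted G X) (Y := X)
    setT (fun a => lie_act a.1 a.2) }.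

Section Symmetry.
Context {R : realType} {d : nat} {G : lie_group R d}.

Definition free_action n (X : manifold R n) (a : lie_action G X) : Prop :=
  forall g x, a g x = x -> g = gone G.

Definition proper_action n (X : manifold R n) (a : lie_action G X) : Prop :=
  forall K : set (X * X), compact K ->
    compact [set b : G * X | K (a b.1 b.2, b.2)].

(* The Lie algebra is T_e G, and xi_X(x) = T_e(g |-> g x) xi; this is a vector
   at e x, that is, at x. *)
Definition generator n (X : manifold R n) (a : lie_action G X) (x : X)
    (xi : 'rV[R]_d) : 'rV[R]_n :=
  tangent_map (X := G) (Y := X) (fun g => a g x) (gone G) xi.

Definition tangent_lift n (X : manifold R n) (a : lie_action G X) (g : G)
    (b : tangent_bundle X) : tangent_bundle X :=
  (a g b.1, tangent_map (X := X) (Y := X) (a g) b.1 b.2).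

(* g (q, p) = (g q, p \o T_(g q) g^-1) *)
Definition cotangent_lift n (X : manifold R n) (a : lie_action G X) (g : G)
    (b : cotangent_bundle X) : cotangent_bundle X :=
  (a g b.1, covec (fun w =>
     pairing b.2 (tangent_map (X := X) (Y := X) (a (ginv g)) (a g b.1) w))).

Definition vertical n (X : manifold R n) (a : lie_action G X) (x : X) :
  {vspace 'rV[R]_n} := limg (linfun (generator a x)).

Definition momentum n (X : manifold R n) (a : lie_action G X)
    (b : cotangent_bundle X) (xi : 'rV[R]_d) : R :=
  pairing b.2 (generator a (bundle_proj b) xi).

(* the fibre at m of the bundle g^H *)
Definition horizontal_symmetry n k r (S : nonholonomic_system R n k)
    (M : manifold R r) (i : M -> cotangent_bundle (conf S))
    (a : lie_action G M) (m : M) : {vspace 'rV[R]_d} :=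
  (linfun (generator a m) @^-1: (vertical a m :&: horizontal i m))%VS.

End Symmetry.

(* Main.v *)
(** Work at a point m of M and put eta = sum_j f_j(m) xi^j, a fixed element of
    the Lie algebra. By the product rule the claim is d J^eta (X_h) = 0 at m.
    Now d J^eta = omega_M (eta_M, .) and eta_M(m) is horizontal, so the Dirac
    condition gives d J^eta (X_h) = - omega_M (X_h, eta_M) = - dh (eta_M), which
    vanishes because h is invariant.

    For d J^eta = omega_M (eta_M, .), let A(s, u) be the action in coordinates
    around (e, q). In the canonical chart J^eta (u, p) = p . D_eta A(e, u), and
    the lifted orbit (u(s), p(s)) of (u, p) satisfies p(s) . D_w A(s, u) = p . w
    for every w; differentiating both and exchanging the mixed derivatives of A
    gives the identity. *)

Require Import Defs.
From HB Require Import structures.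
From mathcomp Require Import all_boot all_order all_algebra.
From mathcomp Require Import all_classical all_reals all_analysis.
From mathcomp Require Import ring.
Import Order.TTheory GRing.Theory Num.Theory.
Import numFieldNormedType.Exports.

Set Implicit Arguments.
Unset Strict Implicit.
Unset Printing Implicit Defensive.

Local Open Scope classical_set_scope.
Local Open Scope ring_scope.

(** * Differential calculus on normed spaces, up to the symmetry of second derivatives *)

Section Differentiation.
Context {R : realType}.

Lemma id_differentiable (V : normedModType R) (x : V) :
  differentiable (id : V -> V) x.
Proof. exact: ex_diff. Qed.

Lemma diff_id (V : normedModType R) (x : V) : 'd id x = id :> (V -> V).
Proof. exact: diff_val. Qed.

(** The first-order expansion at [x] depends only on the germ, and it determines the differential.
    This serves to differentiate identities that hold only inside a chart domain. *)
Lemma near_eq_is_diff (V W : normedModType R) (f g : V -> W) (x : V) :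
  differentiable f x -> (\near x, f x = g x) ->
  differentiable g x /\ 'd g x = 'd f x :> (V -> W).
Proof.
move=> df fg.
have dg : g \o shift x = cst (g x) + 'd f x +o_ 0 id.
  apply/eqaddoP => e e0; have /eqaddoP/(_ e e0) := diff_locally df.
  rewrite -(nbhs_singleton fg); apply: filter_app.
  move: fg; rewrite (near_shift 0 x) subr0; apply: filterS => y /= fgy.
  by rewrite !fctE /= -fgy.
have dfg := diff_unique (diff_continuous df) dg.
split; last exact: dfg.
by apply/diff_locallyP; rewrite dfg; split; first exact: diff_continuous.
Qed.

(** In the standard basis the map is a finite sum of coordinate functions times fixed vectors. *)
Lemma linear_rV_differentiable (n : nat) (W : normedModType R)
  (f : {linear 'rV[R]_n -> W}) (x : 'rV[R]_n) : differentiable f x.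
Proof.
have -> : f = (\sum_(j < n) fun u : 'rV[R]_n => u 0 j *: f (delta_mx 0 j))
    :> (_ -> _).
  apply/funext => u; rewrite [u in LHS]row_sum_delta linear_sum fct_sumE.
  by apply: eq_bigr => j _; rewrite linearZ.
by apply: differentiable_sum => j; apply: differentiableZl;
  exact: differentiable_coord.
Qed.

(** The mean value theorem along [v] turns the second difference into [t] times a difference of two
    values of ['D_v g]; both are then expanded to first order at [x]. *)
Lemma second_difference (V : normedModType R) (g : V -> R^o) (x v w : V)
    (e : R) :
  (\near x, differentiable g x) -> differentiable ('D_v g) x -> 0 < e ->
  \forall t \near 0^'+,
    `|g (x + t *: v + t *: w) - g (x + t *: v) - g (x + t *: w) + g x
      - t ^+ 2 * 'D_w ('D_v g) x| <= t ^+ 2 * e.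
Proof.
move=> dg dG e0.
(* The summand 1 keeps [N] positive when [v] and [w] vanish. Two expansions, each with error at most
   [e' * (t * N)], will be used, hence the factor 2 in [e']. *)
set G := 'D_v g; set N := `|v| + `|w| + 1.
have N0 : 0 < N by rewrite /N ltr_wpDl// addr_ge0.
pose e' := e / (2 * N).
have e'0 : 0 < e' by rewrite divr_gt0// mulr_gt0.
have /eqaddoP/(_ e' e'0) := diff_locally dG.
move: dg; rewrite (near_shift 0 x) subr0 => dg dG'.
have : \forall y \near (0 : V), differentiable g (y + x) /\
    `|G (y + x) - G x - 'd G x y| <= e' * `|y|.
  near=> y; split; first by near: y.
  have : `|(G \o shift x - (cst (G x) + 'd G x)) y| <= e' * `|y| by near: y.
  by rewrite !fctE /= opprD addrA.
move=> /nbhs_normP[r /= r0 rP].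
have {}rP y : `|y| < r -> differentiable g (y + x) /\
    `|G (y + x) - G x - 'd G x y| <= e' * `|y|.
  by move=> yr; apply: rP; rewrite /= sub0r normrN.
near=> t.
have t0 : 0 < t by near: t; exact: nbhs_right_gt.
have tr : t * N < r.
  rewrite -ltr_pdivlMr//; near: t; apply: nbhs_right_lt.
  by rewrite divr_gt0.
have small (a b : R) : 0 <= a <= t -> 0 <= b <= t ->
    `|a *: v + b *: w| <= t * N.
  move=> /andP[a0 at'] /andP[b0 bt].
  rewrite (le_trans (ler_normD _ _))// !normrZ !ger0_norm// /N !mulrDr mulr1.
  by apply: ler_wpDr; [exact: ltW|apply: lerD; exact: ler_wpM2r].
have near_pt (a b : R) : 0 <= a <= t -> 0 <= b <= t ->
    differentiable g (x + a *: v + b *: w) /\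
    `|G (x + a *: v + b *: w) - G x - (a * 'D_v G x + b * 'D_w G x)|
      <= e' * (t * N).
  move=> at' bt; have Nab := small _ _ at' bt.
  have [dgy Gy] := rP _ (le_lt_trans Nab tr).
  have -> : x + a *: v + b *: w = a *: v + b *: w + x by rewrite -addrA addrC.
  split => //; have -> : a * 'D_v G x + b * 'D_w G x = 'd G x (a *: v + b *: w).
    by rewrite linearD !linearZ !deriveE.
  by rewrite (le_trans Gy)// ler_wpM2l// ltW.
have line (s b : R) : 0 <= s <= t -> 0 <= b <= t ->
    is_derive s (1 : R) (fun s => g (x + s *: v + b *: w) : R^o)
      (G (x + s *: v + b *: w)).
  move=> st bt; have [dgp _] := near_pt _ _ st bt.
  set p := x + s *: v + b *: w in dgp *.
  have E : (fun h : R => h^-1 *: (((fun s => g (x + s *: v + b *: w) : R^o)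
      \o shift s) (h *: 1) - g p))
      = (fun h : R => h^-1 *: ((g \o shift p) (h *: v) - g p)).
    apply/funext => h /=; congr (_ *: (g _ - _)).
    by rewrite [h *: 1]mulr1 scalerDl addrCA /p -!addrA.
  split.
    by rewrite /derivable E; exact: diff_derivable.
  by rewrite /derive E.
(* The second difference is [phi t - phi 0], to which the mean value theorem
   applies. *)
pose phi s : R^o := g (x + s *: v + t *: w) - g (x + s *: v + 0 *: w).
have tt : 0 <= t <= t by rewrite ltW/=.
have t00 : 0 <= (0 : R) <= t by rewrite lexx ltW.
have dphi (s : R) : 0 <= s <= t -> is_derive s (1 : R) phi
    (G (x + s *: v + t *: w) - G (x + s *: v + 0 *: w)).
  by move=> st; apply: is_deriveB; apply: line.
have [|||s] := @MVT_segment R phi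
   (fun s => G (x + s *: v + t *: w) - G (x + s *: v + 0 *: w)) 0 t.
- exact: ltW.
- by move=> s; rewrite in_itv/= => /andP[s0 st]; apply: dphi; rewrite !ltW.
- apply: derivable_within_continuous => s; rewrite in_itv/= => st.
  by have [] := dphi _ st.
rewrite in_itv /= subr0 => st phiE.
have -> : g (x + t *: v + t *: w) - g (x + t *: v) - g (x + t *: w) + g x
  = phi t - phi 0.
  by rewrite /phi !scale0r !addr0 opprB addrA addrAC.
rewrite phiE.
have [_ P1] := near_pt _ _ st tt; have [_ P2] := near_pt _ _ st t00.
set A := G _ in P1 *; set B := G _ in P2 *.
(* In the difference of the two expansions [G x] and the term in the unknown mean value point [s]
   cancel; only [t * 'D_w G x] survives. *)
have -> : (A - B) * t - t ^+ 2 * 'D_w G x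
  = t * ((A - G x - (s * 'D_v G x + t * 'D_w G x))
         - (B - G x - (s * 'D_v G x + 0 * 'D_w G x))).
  by move: A B (G x) ('D_v G x : R) ('D_w G x : R) {P1 P2} => A B C D E; ring.
rewrite normrM (gtr0_norm t0) expr2 -(mulrA t t e) ler_pM2l//.
apply: (le_trans (ler_normB _ _)); apply: (le_trans (lerD P1 P2)).
have -> : e' * (t * N) + e' * (t * N) = t * e.
  by rewrite /e'; field; exact: lt0r_neq0.
exact: lexx.
Unshelve. all: by end_near. Qed.

(** The second difference is symmetric in [v] and [w], so for a common small [t] it approximates
    [t ^+ 2] times either mixed derivative. Dividing by [t ^+ 2] bounds their distance by any
    [e]. *)
Lemma derive_comm_scalar (V : normedModType R) (g : V -> R^o) (x v w : V) :
  (\near x, differentiable g x) ->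
  differentiable ('D_v g) x -> differentiable ('D_w g) x ->
  'D_v ('D_w g) x = 'D_w ('D_v g) x.
Proof.
move=> dg dv dw; apply/eqP; rewrite -subr_eq0 -normr_le0.
apply/ler_addgt0Pr => e e0; rewrite add0r.
have e20 : 0 < e / 2 by rewrite divr_gt0.
have Hv := second_difference w dg dv e20.
have Hw := second_difference v dg dw e20.
have [t [[t0 Hvt] Hwt]] := filter_ex (filterI (filterI (nbhs_right_gt (0 : R)) Hv) Hw).
rewrite /= in t0 Hvt Hwt.
have t2 : 0 < t ^+ 2 by rewrite exprn_gt0.
rewrite -(ler_pM2l t2) -{1}(gtr0_norm t2) -normrM.
rewrite (addrAC x (t *: w)) in Hwt.
move: (g (x + t *: v + t *: w)) (g (x + t *: v)) (g (x + t *: w)) (g x)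
  ('D_w _ x) ('D_v _ x) Hvt Hwt => A B C D p q Hvt Hwt.
have -> : t ^+ 2 * (q - p) =
    (A - B - C + D - t ^+ 2 * p) - (A - C - B + D - t ^+ 2 * q).
  by ring.
rewrite (le_trans (ler_normB _ _))// (le_trans (lerD Hvt Hwt))//.
by rewrite -mulrDr -splitr.
Unshelve. all: by end_near. Qed.

(** Reduction to the scalar case, one coordinate at a time; a coordinate of ['D_v F] is the
    derivative of that coordinate of [F] only near [x], where [F] is differentiable. *)
Lemma derive_comm (V : normedModType R) m (F : V -> 'rV[R]_m) (x v w : V) :
  (\near x, differentiable F x) ->
  differentiable ('D_v F) x -> differentiable ('D_w F) x ->
  'D_v ('D_w F) x = 'D_w ('D_v F) x.
Proof.
have coordE (H : V -> 'rV[R]_m) (u : V) (j : 'I_m) y : differentiable H y ->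
    'D_u H y 0 j = 'D_u (fun y => H y 0 j : R^o) y.
  by move=> dH; rewrite (derive_mx (diff_derivable (v := u) dH)) mxE.
move=> dF dv dw; apply/rowP => j.
have dj (H : V -> 'rV[R]_m) y : differentiable H y ->
    differentiable (fun y => H y 0 j : R^o) y.
  move=> dH; apply: (differentiable_comp (g := fun p : 'rV[R]_m => p 0 j : R^o)) => //.
  exact: differentiable_coord.
have near_coordE (u : V) : \near x, 'D_u F x 0 j = 'D_u (fun y => F y 0 j : R^o) x.
  by near=> y; apply: coordE; near: y.
apply: (etrans (coordE _ v j x dw)).
apply: (etrans (near_eq_derive v (near_coordE w))).
apply: (etrans _ (esym (coordE _ w j x dv))).
apply: (etrans _ (esym (near_eq_derive w (near_coordE v)))).
apply: derive_comm_scalar.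
- by near=> y; apply: dj; near: y.
- by have [] := near_eq_is_diff (dj _ _ dv) (near_coordE v).
- by have [] := near_eq_is_diff (dj _ _ dw) (near_coordE w).
Unshelve. all: by end_near. Qed.

Lemma diff_linear_comp (V W : normedModType R) n (f : V -> 'rV[R]_n)
    (L : {linear 'rV[R]_n -> W}) (x : V) : differentiable f x ->
  differentiable (L \o f) x /\ 'd (L \o f) x = L \o 'd f x :> (V -> W).
Proof.
move=> df; have dL y : differentiable L y by exact: linear_rV_differentiable.
split; first exact: differentiable_comp.
rewrite diff_comp// diff_lin// => y.
exact/differentiable_continuous.
Qed.

Lemma diff_row_mx (V : normedModType R) m n (f : V -> 'rV[R]_m)
    (g : V -> 'rV[R]_n) (x : V) : differentiable f x -> differentiable g x ->
  differentiable (fun y => row_mx (f y) (g y)) x /\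
  'd (fun y => row_mx (f y) (g y)) x
    = (fun v => row_mx ('d f x v) ('d g x v)) :> (V -> _).
Proof.
move=> df dg.
(* [L1] and [L2] are the two block inclusions, so that juxtaposition becomes a sum of linear
   images. *)
pose L1 : {linear 'rV[R]_m -> 'rV[R]_(m + n)} :=
  mulmxr (row_mx (1%:M : 'M[R]_m) (0 : 'M[R]_(m, n))).
pose L2 : {linear 'rV[R]_n -> 'rV[R]_(m + n)} :=
  mulmxr (row_mx (0 : 'M[R]_(n, m)) (1%:M : 'M[R]_n)).
have rowE (a : 'rV[R]_m) (b : 'rV[R]_n) : row_mx a b = L1 a + L2 b.
  by rewrite /= !mul_mx_row !mulmx1 !mulmx0 add_row_mx addr0 add0r.
have [d1 E1] := diff_linear_comp L1 df.
have [d2 E2] := diff_linear_comp L2 dg.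
have -> : (fun y => row_mx (f y) (g y)) = (L1 \o f) + (L2 \o g).
  by apply/funext => y; rewrite rowE.
split; first exact: differentiableD.
apply: (etrans (diffD d1 d2)); apply/funext => v.
by rewrite rowE; apply: (congr2 +%R (congr1 (@^~ v) E1) (congr1 (@^~ v) E2)).
Qed.

Lemma row_mxl_differentiable d n (s : 'rV[R]_d) (u : 'rV[R]_n) :
  differentiable (fun s => row_mx s u) s.
Proof.
by have [] := diff_row_mx (id_differentiable s) (differentiable_cst u s).
Qed.

Lemma row_mxr_differentiable d n (s : 'rV[R]_d) (u : 'rV[R]_n) :
  differentiable (fun u => row_mx s u) u.
Proof.
by have [] := diff_row_mx (differentiable_cst s u) (id_differentiable u).
Qed.

Lemma Cinf_differentiable (V W : normedModType R) (A : set V) (f : V -> W) x :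
  Cinf A f -> A x -> differentiable f x.
Proof. by move=> /(_ 1%N)[+ _]; apply. Qed.

Lemma Cinf_derive (V W : normedModType R) (A : set V) (f : V -> W) v :
  Cinf A f -> Cinf A (fun x => 'D_v f x).
Proof. by move=> fA k; have [_] := fA k.+1; apply. Qed.

End Differentiation.

(** * Covectors, the pairing and the canonical form *)

Section Pairing.
Context {R : realType}.

Lemma pairingE n (p v : 'rV[R]_n) : pairing p v = \sum_j p 0 j * v 0 j.
Proof. by rewrite /pairing mxE; apply: eq_bigr => j _; rewrite mxE. Qed.

Lemma pairingBl n (p q v : 'rV[R]_n) : pairing (p - q) v = pairing p v - pairing q v.
Proof. by rewrite /pairing mulmxBl !mxE. Qed.

(** Expansion of [w] in the standard basis. Linearity is asked of a bare function, so that forms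
    such as [omegaM i m v] qualify. *)
Lemma pairing_covec n (l : 'rV[R]_n -> R) (w : 'rV[R]_n) :
  (forall a u v, l (a *: u + v) = a * l u + l v) -> pairing (covec l) w = l w.
Proof.
move=> linl; pose L := GRing.isLinear.Build R 'rV[R]_n R^o _ l linl.
pose l' : {linear 'rV[R]_n -> R^o} := HB.pack (l : 'rV[R]_n -> R^o) L.
rewrite -[RHS]/(l' w) [w in RHS]row_sum_delta linear_sum pairingE.
by apply: eq_bigr => j _; rewrite linearZ /= mxE mulrC.
Qed.

Lemma pairing_linear n (p : 'rV[R]_n) a u v :
  pairing p (a *: u + v) = a * pairing p u + pairing p v.
Proof. by rewrite /pairing linearP mulmxDr -scalemxAr !mxE. Qed.

Lemma pairing_covec_pullback m n (p : 'rV[R]_m)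
    (L : {linear 'rV[R]_n -> 'rV[R]_m}) (w : 'rV[R]_n) :
  pairing (covec (fun v => pairing p (L v))) w = pairing p (L w).
Proof. by apply: pairing_covec => a u v; rewrite linearP pairing_linear. Qed.

Lemma diff_pairing (V : normedModType R) n (p w : V -> 'rV[R]_n) (x : V) :
  differentiable p x -> differentiable w x ->
  differentiable (fun y => pairing (p y) (w y) : R^o) x /\
  forall v, 'd (fun y => pairing (p y) (w y) : R^o) x v
            = pairing ('d p x v) (w x) + pairing (p x) ('d w x v).
Proof.
move=> dp dw.
have dj (q : V -> 'rV[R]_n) (j : 'I_n) : differentiable q x ->
    differentiable (fun y => q y 0 j : R^o) x.
  move=> dq; apply: (differentiable_comp (g := fun u : 'rV[R]_n => u 0 j : R^o)) => //.
  exact: differentiable_coord.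
have Dj (q : V -> 'rV[R]_n) (j : 'I_n) v : differentiable q x ->
    'D_v (fun y => q y 0 j : R^o) x = 'd q x v 0 j.
  by move=> dq; rewrite -deriveE// (derive_mx (diff_derivable (v := v) dq)) mxE.
pose F j : V -> R^o := (fun y => p y 0 j : R^o) * (fun y => w y 0 j : R^o).
have dF j : differentiable (F j) x by apply: differentiableM; exact: dj.
have -> : (fun y => pairing (p y) (w y) : R^o) = \sum_j F j.
  by apply/funext => y; rewrite pairingE fct_sumE.
split; first exact: differentiable_sum.
move=> v; rewrite -deriveE; last exact: differentiable_sum.
rewrite derive_sum; last by move=> j; exact: diff_derivable.
rewrite !pairingE -big_split /=; apply: eq_bigr => j _.
rewrite deriveM; [|exact: diff_derivable (dj _ _ _)..].
apply: (etrans (congr2 +%R (congr1 (fun z => p x 0 j * z) (Dj w j v dw))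
                           (congr1 (fun z => w x 0 j * z) (Dj p j v dp)))).
by rewrite addrC (mulrC (w x 0 j)).
Qed.

Lemma omega_can_anti n (X : charted R n) (c : cotangent_bundle X)
    (u v : 'rV[R]_(n + n)) : omega_can c u v = - omega_can c v u.
Proof.
rewrite /omega_can -sumrN; apply: eq_bigr => j _.
by rewrite opprB mulrC (mulrC (rsubmx u 0 j)).
Qed.

Lemma omegaM_linear n k r (S : nonholonomic_system R n k) (M : manifold R r)
    (i : M -> cotangent_bundle (conf S)) (m : M) (v : 'rV[R]_r)
    (a : R) (u w : 'rV[R]_r) :
  omegaM i m v (a *: u + w) = a * omegaM i m v u + omegaM i m v w.
Proof.
rewrite /omegaM /omega_can mulr_sumr -big_split /=; apply: eq_bigr => j _.
by rewrite /tangent_map linearP !mxE; ring.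
Qed.

End Pairing.

(** * The Hamiltonian property of the momentum, in coordinates *)

Section NoetherInChart.
Context {R : realType}.

(* [gamma] is the orbit of [iota x] in the canonical chart; the sum is
   [omega_can] of the two differentials. *)
Lemma noether_in_chart (V : normedModType R) d n
    (A : 'rV[R]_(d + n) -> 'rV[R]_n) (B : set 'rV[R]_(d + n))
    (s0 eta : 'rV[R]_d) (gamma : 'rV[R]_d -> 'rV[R]_(n + n))
    (iota : V -> 'rV[R]_(n + n)) (x : V) :
  let u0 := lsubmx (iota x) in
  open B -> Cinf B A -> B (row_mx s0 u0) ->
  differentiable gamma s0 -> differentiable iota x -> gamma s0 = iota x ->
  (\near u0, A (row_mx s0 u0) = u0) ->
  (\near s0, lsubmx (gamma s0) = A (row_mx s0 u0)) ->
  (forall w, exists c, \near s0,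
     pairing (rsubmx (gamma s0)) ('D_(row_mx 0 w) A (row_mx s0 u0)) = c) ->
  let J y : R^o := pairing (rsubmx (iota y))
    ('D_(row_mx eta 0) A (row_mx s0 (lsubmx (iota y)))) in
  differentiable J x /\
  forall v, let a := 'd gamma s0 eta in let b := 'd iota x v in
    'd J x v = \sum_i (lsubmx a 0 i * rsubmx b 0 i - rsubmx a 0 i * lsubmx b 0 i).
Proof.
move=> u0 oB cA Bz dg di gi Aid lg pg J; set z0 := row_mx s0 u0 in Bz.
have dA : differentiable A z0 by exact: Cinf_differentiable cA Bz.
have dDA v : differentiable (fun z => 'D_v A z) z0.
  exact: Cinf_differentiable (Cinf_derive _ cA) Bz.
have [dgl gl] := diff_linear_comp (@lsubmx R 1 n n) dg.
have [dgr gr] := diff_linear_comp (@rsubmx R 1 n n) dg.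
have [dil il] := diff_linear_comp (@lsubmx R 1 n n) di.
have [dir ir] := diff_linear_comp (@rsubmx R 1 n n) di.
have [ds Es] := diff_row_mx (id_differentiable s0) (differentiable_cst u0 s0).
have [du Eu] := diff_row_mx (differentiable_cst s0 u0) (id_differentiable u0).
have dcs (W : normedModType R) (F : 'rV[R]_(d + n) -> W) : differentiable F z0 ->
    differentiable (fun s => F (row_mx s u0)) s0 /\
    forall v, 'd (fun s => F (row_mx s u0)) s0 v = 'D_(row_mx v 0) F z0.
  move=> dF; split; first exact: (differentiable_comp ds dF).
  move=> v; rewrite deriveE//.
  apply: (etrans (congr1 (@^~ v) (diff_comp ds dF))).
  by rewrite /= (congr1 (@^~ v) Es) !diff_val.
have dcu (W : normedModType R) (F : 'rV[R]_(d + n) -> W) : differentiable F z0 ->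
    differentiable (fun u => F (row_mx s0 u)) u0 /\
    forall v, 'd (fun u => F (row_mx s0 u)) u0 v = 'D_(row_mx 0 v) F z0.
  move=> dF; split; first exact: (differentiable_comp du dF).
  move=> v; rewrite deriveE//.
  apply: (etrans (congr1 (@^~ v) (diff_comp du dF))).
  by rewrite /= (congr1 (@^~ v) Eu) !diff_val.
(* Derivative of [Aid]: on the slice [s0] the map [A] is the identity near [u0]. *)
have Dw w : 'D_(row_mx 0 w) A z0 = w.
  have [dAu <-] := dcu _ _ dA.
  by have [_ <-] := near_eq_is_diff dAu Aid; rewrite diff_val.
have [dDu Du] := dcu _ _ (dDA (row_mx eta 0)).
have dDiota := differentiable_comp dil dDu.
have [dJ EJ] := diff_pairing dir dDiota.
split; first exact: dJ.
move=> v a b.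
pose w := lsubmx b; pose P := rsubmx (iota x).
have EDiota : 'd ((fun u => 'D_(row_mx eta 0) A (row_mx s0 u)) \o (lsubmx \o iota)) x v
    = 'D_(row_mx 0 w) (fun z => 'D_(row_mx eta 0) A z) z0.
  apply: (etrans (congr1 (@^~ v) (diff_comp dil dDu))).
  by apply: (etrans (Du _)); congr ('D_(row_mx 0 _) _ _); exact: (congr1 (@^~ v) il).
have EdJ : 'd J x v = pairing (rsubmx b) ('D_(row_mx eta 0) A z0)
    + pairing P ('D_(row_mx 0 w) (fun z => 'D_(row_mx eta 0) A z) z0).
  apply: (etrans (EJ v)).
  congr (_ + _); congr (pairing _ _); last exact: EDiota.
  exact: (congr1 (@^~ v) ir).
(* The base component of the orbit's velocity, from [lg]. *)
have la : lsubmx a = 'D_(row_mx eta 0) A z0.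
  have [dAs <-] := dcs _ _ dA.
  apply: (etrans (esym (congr1 (@^~ eta) gl))).
  by have [_ E] := near_eq_is_diff dgl lg; exact: esym (congr1 (@^~ eta) E).
(* Derivative at [s0] along [eta] of the pairing that [pg] makes constant; [Dw] simplifies its first
   term. *)
have rb : pairing (rsubmx a) w +
    pairing P ('D_(row_mx eta 0) (fun z => 'D_(row_mx 0 w) A z) z0) = 0.
  have [dDs Ds] := dcs _ _ (dDA (row_mx 0 w)).
  have [dK EK] := diff_pairing dgr dDs.
  have [c Kc] := pg w.
  have [_ E] := near_eq_is_diff dK Kc.
  have <- : 'd (fun=> c : R^o) s0 eta = 0 by rewrite diff_val.
  apply: (etrans _ (esym (congr1 (@^~ eta) E))); apply: (etrans _ (esym (EK eta))).
  congr (_ + _).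
    by congr (pairing _ _); [exact: esym (congr1 (@^~ eta) gr)|rewrite /= Dw].
  congr (pairing _ _); last exact: esym (Ds eta).
  exact: esym (congr1 rsubmx gi).
have nA : \near z0, differentiable A z0.
  have : \near z0, B z0 by exact: open_nbhs_nbhs.
  by apply: filterS => z; exact: Cinf_differentiable.
(* Once the mixed derivatives of [A] are exchanged, the second term of [EdJ] is the one that [rb]
   equates with [- pairing (rsubmx a) w]. *)
rewrite EdJ (derive_comm nA (dDA _) (dDA _)) la.
move/eqP: rb; rewrite addrC addr_eq0 => /eqP ->.
rewrite !pairingE -sumrB; apply: eq_bigr => j _.
by rewrite [X in X - _]mulrC.
Qed.

End NoetherInChart.

(** * Differentiation through the charts of a manifold *)

Section Charts.
Context {R : realType}.

(** Chain rule across an intermediate manifold: near [u], [cinv] after [cmap] can be inserted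
    between [f] and [g]. *)
Lemma diff_through_chart n (X : manifold R n) (V W : normedModType R)
    (x : X) (f : V -> X) (g : X -> W) (u : V) :
  (\near u, cdom (mchart_at x) (f u)) ->
  differentiable (cmap (mchart_at x) \o f) u ->
  differentiable (g \o cinv (mchart_at x)) (cmap (mchart_at x) (f u)) ->
  differentiable (g \o f) u /\
  'd (g \o f) u = 'd (g \o cinv (mchart_at x)) (cmap (mchart_at x) (f u))
                    \o 'd (cmap (mchart_at x) \o f) u :> (V -> W).
Proof.
move=> fx df dg.
have [|dgf ->] := near_eq_is_diff (differentiable_comp df dg) (g := g \o f).
  by near do rewrite /= cmapK //.
by split; rewrite ?diff_comp.
Unshelve. all: by end_near. Qed.

Lemma transition_differentiable n (X : manifold R n) (x y : X) (u : 'rV[R]_n) :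
  ccod (mchart_at x) u -> cdom (mchart_at y) (cinv (mchart_at x) u) ->
  differentiable (transition (X := X) x y) u.
Proof.
by move=> xu yu; exact: Cinf_differentiable (transition_smooth x y) (conj xu yu).
Qed.

Lemma smooth_map_chart n m (X : charted R n) (Y : charted R m) (f : X -> Y)
    (x : X) (y : Y) (u : 'rV[R]_n) :
  smooth_map setT f -> ccod (chart_at x) u ->
  cdom (chart_at y) (f (cinv (chart_at x) u)) ->
  (\near u, ccod (chart_at x) u /\ cdom (chart_at y) (f (cinv (chart_at x) u)))
  /\ differentiable (cmap (chart_at y) \o f \o cinv (chart_at x)) u.
Proof.
move=> sf xu yu; have /= [oB cB] := sf x y.
split; last by apply: (Cinf_differentiable cB).
near=> v.
suff [] : [set u | [/\ ccod (chart_at x) u, setT (cinv (chart_at x) u) &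
  cdom (chart_at y) (f (cinv (chart_at x) u))]] v by [].
by near: v; apply: open_nbhs_nbhs.
Unshelve. all: by end_near. Qed.

End Charts.

(** * Lie group actions and their lifts in coordinates *)

Section Action.
Context {R : realType}.
Context {d : nat} {G : lie_group R d} {n : nat} {X : manifold R n}.
Context (a : lie_action G X).

(** Group and space coordinates share one row vector, so the derivatives along [row_mx eta 0] and
    [row_mx 0 w] are directional derivatives of a single map and commute. *)
Definition action_chart (g : G) (x y : X) (z : 'rV[R]_(d + n)) : 'rV[R]_n :=
  cmap (mchart_at y)
    (a (cinv (mchart_at g) (lsubmx z)) (cinv (mchart_at x) (rsubmx z))).

Definition action_chart_dom (g : G) (x y : X) : set 'rV[R]_(d + n) :=
  [set z | [/\ ccod (mchart_at g) (lsubmx z), ccod (mchart_at x) (rsubmx z) &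
    cdom (mchart_at y)
      (a (cinv (mchart_at g) (lsubmx z)) (cinv (mchart_at x) (rsubmx z)))]].

(** This is [lie_act_smooth] read in the product chart centred at [(g, x)]; only the form of the
    domain conditions differs. *)
Lemma action_chart_smooth (g : G) (x y : X) :
  open (action_chart_dom g x y) /\
  Cinf (action_chart_dom g x y) (action_chart g x y).
Proof.
have /= := @lie_act_smooth _ _ _ _ _ a (g, x) y.
set B := (B in open B) => -[oB cB].
have -> : action_chart_dom g x y = B.
  by apply/seteqP; split=> z; [case=> *; split|case=> -[? ?] _ ?; split].
by [].
Qed.

Lemma action_chart_comp (V : normedModType R) (rho : V -> 'rV[R]_(d + n))
    (g : G) (x y : X) (p : V) :
  differentiable rho p -> action_chart_dom g x y (rho p) ->
  (\near p, action_chart_dom g x y (rho p)) /\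
  differentiable (action_chart g x y \o rho) p.
Proof.
have [oB cB] := action_chart_smooth g x y.
move=> drho Bp; split; last first.
  by apply: differentiable_comp => //; exact: Cinf_differentiable cB Bp.
by apply: (differentiable_continuous drho); exact: open_nbhs_nbhs.
Qed.

Lemma action_differentiable (g : G) (x y : X) (u : 'rV[R]_n) :
  ccod (mchart_at x) u -> cdom (mchart_at y) (a g (cinv (mchart_at x) u)) ->
  (\near u, cdom (mchart_at y) (a g (cinv (mchart_at x) u))) /\
  differentiable (cmap (mchart_at y) \o (a g \o cinv (mchart_at x))) u.
Proof.
move=> xu yu; pose s := cmap (mchart_at g) g.
have gs : cinv (mchart_at g) s = g by rewrite cmapK//; exact: mem_cdom.
have Bsu : action_chart_dom g x y (row_mx s u).
  split; rewrite ?row_mxKl ?row_mxKr ?gs//; exact/cmap_cod/mem_cdom.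
have [nB dA] := action_chart_comp (row_mxr_differentiable s u) Bsu.
split.
  by apply: filterS nB => v [_ _]; rewrite row_mxKl row_mxKr gs.
rewrite (_ : _ \o _ = action_chart g x y \o (fun u => row_mx s u))//.
by apply/funext => v; rewrite /= /action_chart row_mxKl row_mxKr gs.
Qed.

Lemma orbit_differentiable (g : G) (x y : X) (s : 'rV[R]_d) :
  ccod (mchart_at g) s -> cdom (mchart_at y) (a (cinv (mchart_at g) s) x) ->
  (\near s, cdom (mchart_at y) (a (cinv (mchart_at g) s) x)) /\
  differentiable (cmap (mchart_at y) \o (fun s => a (cinv (mchart_at g) s) x)) s.
Proof.
move=> gs ys; pose u := cmap (mchart_at x) x.
have xu : cinv (mchart_at x) u = x by rewrite cmapK//; exact: mem_cdom.
have Bsu : action_chart_dom g x y (row_mx s u).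
  split; rewrite ?row_mxKl ?row_mxKr ?xu//; exact/cmap_cod/mem_cdom.
have [nB dA] := action_chart_comp (row_mxl_differentiable s u) Bsu.
split.
  by apply: filterS nB => v [_ _]; rewrite row_mxKl row_mxKr xu.
rewrite (_ : _ \o _ = action_chart g x y \o (fun s => row_mx s u))//.
by apply/funext => v; rewrite /= /action_chart row_mxKl row_mxKr xu.
Qed.

Lemma action_chart_partial (g : G) (x y : X) (s : 'rV[R]_d) (u w : 'rV[R]_n) :
  action_chart_dom g x y (row_mx s u) ->
  'D_(row_mx 0 w) (action_chart g x y) (row_mx s u)
  = 'd (cmap (mchart_at y) \o (a (cinv (mchart_at g) s) \o cinv (mchart_at x))) u w.
Proof.
have [oB cB] := action_chart_smooth g x y.
move=> Bz; have dA := Cinf_differentiable cB Bz.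
rewrite (_ : _ \o _ = action_chart g x y \o (fun u => row_mx s u)); last first.
  by apply/funext => v; rewrite /= /action_chart row_mxKl row_mxKr.
have [dr Er] := diff_row_mx (differentiable_cst s u) (id_differentiable u).
rewrite deriveE//.
apply: (etrans _ (esym (congr1 (@^~ w) (diff_comp (row_mxr_differentiable s u) dA)))).
by rewrite /= (congr1 (@^~ w) Er) !diff_val.
Qed.

Let e := gone G.
Let s0 := cmap (mchart_at e) e.

Let e_cdom : cdom (mchart_at e) e. Proof. exact: mem_cdom. Qed.
Let s0_ccod : ccod (mchart_at e) s0. Proof. exact: cmap_cod. Qed.
Let s0K : cinv (mchart_at e) s0 = e. Proof. exact: cmapK. Qed.

Lemma action_chart_dom_one (x y : X) : cdom (mchart_at x) y ->
  action_chart_dom e x x (row_mx s0 (cmap (mchart_at x) y)).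
Proof.
move=> xy; rewrite /action_chart_dom /= row_mxKl row_mxKr s0K cmapK// lie_act1.
by split=> //; exact: cmap_cod.
Qed.

(** The generator has its components in the chart preferred at [y]. Factoring the orbit through the
    chart at [x] gives a formula in which that chart stays fixed while [y] varies. *)
Lemma generator_chart (x y : X) (eta : 'rV[R]_d) : cdom (mchart_at x) y ->
  generator a y eta = 'd (transition (X := X) x y) (cmap (mchart_at x) y)
    ('D_(row_mx eta 0) (action_chart e x x) (row_mx s0 (cmap (mchart_at x) y))).
Proof.
move=> xy; set u := cmap (mchart_at x) y.
have uK : cinv (mchart_at x) u = y by exact: cmapK.
pose f s := a (cinv (mchart_at e) s) y.
have fs0 : f s0 = y by rewrite /f s0K lie_act1.
have xf : cdom (mchart_at x) (f s0) by rewrite fs0.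
have [nf df] := orbit_differentiable s0_ccod xf.
have dt : differentiable (cmap (mchart_at y) \o cinv (mchart_at x))
    (cmap (mchart_at x) (f s0)).
  rewrite fs0; apply: transition_differentiable; first exact: cmap_cod.
  by rewrite uK; exact: mem_cdom.
have [_ E] := diff_through_chart nf df dt.
rewrite /generator /tangent_map lie_act1.
apply: (etrans (congr1 (@^~ eta) E)); rewrite /= -/(f s0) fs0; congr ('d _ _ _).
have [oB cB] := action_chart_smooth e x x.
have dA := Cinf_differentiable cB (action_chart_dom_one xy).
have [dr Er] := diff_row_mx (id_differentiable s0) (differentiable_cst u s0).
rewrite deriveE//.
rewrite (_ : _ \o _ = action_chart e x x \o (fun s => row_mx s u)); last first.
  by apply/funext => s; rewrite /= /action_chart row_mxKl row_mxKr uK.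
apply: (etrans (congr1 (@^~ eta) (diff_comp (row_mxl_differentiable s0 u) dA))).
by rewrite /= (congr1 (@^~ eta) Er) !diff_val.
Qed.

(** The transition in [generator_chart] is the one along which the canonical chart at [c] pulls
    covectors back, so it is absorbed into the fibre coordinates of [b]. *)
Lemma momentum_chart (c b : cotangent_bundle X) (eta : 'rV[R]_d) :
  cdom (mchart_at c.1) b.1 ->
  momentum a b eta = pairing (rsubmx (cmap (chart_at c) b))
    ('D_(row_mx eta 0) (action_chart e c.1 c.1)
       (row_mx s0 (lsubmx (cmap (chart_at c) b)))).
Proof.
move=> cb; rewrite /momentum /bundle_proj (generator_chart _ cb).
by rewrite /= row_mxKl row_mxKr pairing_covec_pullback.
Qed.

(** The lift pulls [c.2] back along the inverse of [g], which undoes the tangent map of [g] applied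
    to [w]. The work lies in passing between the charts at [x] and at [a g x]. *)
Lemma cotangent_lift_chart (c : cotangent_bundle X) (g : G) (w : 'rV[R]_n) :
  cdom (mchart_at c.1) (a g c.1) ->
  pairing (rsubmx (cmap (chart_at c) (cotangent_lift a g c)))
    ('d (cmap (mchart_at c.1) \o (a g \o cinv (mchart_at c.1)))
       (cmap (mchart_at c.1) c.1) w) = pairing c.2 w.
Proof.
case: c => x p /= xg; set u := cmap (mchart_at x) x.
have uK : cinv (mchart_at x) u = x by exact/cmapK/mem_cdom.
have xu : ccod (mchart_at x) u by exact/cmap_cod/mem_cdom.
have gK : a (ginv g) (a g x) = x by rewrite -lie_actM gmulV lie_act1.
rewrite row_mxKr pairing_covec_pullback /tangent_map pairing_covec_pullback.
congr (pairing p _); rewrite gK /=.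
have xf : cdom (mchart_at x) (a g (cinv (mchart_at x) u)) by rewrite uK.
have [nf df] := action_differentiable xu xf.
have gxf : cdom (mchart_at (a g x)) (a g (cinv (mchart_at x) u)).
  by rewrite uK; exact: mem_cdom.
have [ng dg] := action_differentiable xu gxf.
have xh : cdom (mchart_at x) (a (ginv g) (cinv (mchart_at (a g x))
    (cmap (mchart_at (a g x)) (a g x)))).
  by rewrite cmapK ?gK; exact: mem_cdom.
have [_ dh] := action_differentiable (cmap_cod (mem_cdom (a g x))) xh.
have dt : differentiable (cmap (mchart_at (a g x)) \o cinv (mchart_at x))
    (cmap (mchart_at x) (a g (cinv (mchart_at x) u))).
  rewrite uK; apply: transition_differentiable; first exact: cmap_cod.
  by rewrite cmapK//; exact: mem_cdom.
have [_ E1] := diff_through_chart nf df dt.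
have dh' : differentiable ((cmap (mchart_at x) \o a (ginv g)) \o
    cinv (mchart_at (a g x)))
    (cmap (mchart_at (a g x)) ((a g \o cinv (mchart_at x)) u)).
  by rewrite /= uK.
have [_ E2] := diff_through_chart ng dg dh'.
(* Differentiating [ginv g] after [g], which is the identity near [u], through the chart at [a g x]
   gives [W2]. *)
have Eid : \near u, u = ((cmap (mchart_at x) \o a (ginv g)) \o
     (a g \o cinv (mchart_at x))) u.
  have : \near u, ccod (mchart_at x) u.
    by apply: open_nbhs_nbhs; split=> //; exact: open_ccod.
  by apply: filterS => v xv; rewrite /= -lie_actM gmulV lie_act1 cinvK.
have [_ E3] := near_eq_is_diff (id_differentiable u) Eid.
have W1 : 'd (cmap (mchart_at (a g x)) \o (a g \o cinv (mchart_at x))) u w =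
    'd (transition (X := X) x (a g x)) (cmap (mchart_at x) (a g x))
      ('d (cmap (mchart_at x) \o (a g \o cinv (mchart_at x))) u w).
  apply: (etrans (congr1 (@^~ w) E1)).
  exact: (congr1 (fun q => 'd (transition (X := X) x (a g x))
    (cmap (mchart_at x) (a g q))
    ('d (cmap (mchart_at x) \o (a g \o cinv (mchart_at x))) u w)) uK).
have W2 : 'd (cmap (mchart_at x) \o a (ginv g) \o cinv (mchart_at (a g x)))
      (base (X := X) (a g x))
      ('d (cmap (mchart_at (a g x)) \o (a g \o cinv (mchart_at x))) u w) = w.
  apply: (etrans _ (congr1 (@^~ w) (diff_id u))).
  apply: (etrans _ (congr1 (@^~ w) E3)).
  apply: (etrans _ (esym (congr1 (@^~ w) E2))).
  exact: (congr1 (fun q => 'd (cmap (mchart_at x) \o a (ginv g) \o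
      cinv (mchart_at (a g x))) (cmap (mchart_at (a g x)) (a g q))
      ('d (cmap (mchart_at (a g x)) \o (a g \o cinv (mchart_at x))) u w))
    (esym uK)).
apply: (etrans _ W2); congr ('d _ _ _); exact: esym W1.
Qed.

End Action.

(** * Invariant functions and the differential of the momentum map *)

Section Momentum.
Context {R : realType} {d : nat} {G : lie_group R d}.

Lemma momentum_sum n (X : manifold R n) (a : lie_action G X)
    (b : cotangent_bundle X) k (c : 'I_k -> R) (zeta : 'I_k -> 'rV[R]_d) :
  momentum a b (\sum_j c j *: zeta j) = \sum_j c j * momentum a b (zeta j).
Proof.
rewrite /momentum /generator /tangent_map linear_sum.
rewrite /pairing [(\sum_j _)^T]linear_sum mulmx_sumr summxE.
by apply: eq_bigr => j _; rewrite linearZ /= linearZ /= -scalemxAr mxE.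
Qed.

Lemma generator_lfunE n (X : manifold R n) (a : lie_action G X) (x : X)
    (zeta : 'rV[R]_d) :
  linfun (generator a x) zeta = generator a x zeta.
Proof. exact: lfunE. Qed.

(** Chain rule for [h] along the orbit of [m], on which [h] is constant. *)
Lemma dfun_invariant r (M : manifold R r) (a : lie_action G M) (h : M -> R)
    (m : M) (zeta : 'rV[R]_d) :
  smooth_fun (X := M) setT h -> (forall g m, h (a g m) = h m) ->
  dfun (X := M) h m (generator a m zeta) = 0.
Proof.
move=> h_smooth h_inv.
set e := gone G; set s0 := cmap (mchart_at e) e.
have s0K : cinv (mchart_at e) s0 = e by exact/cmapK/mem_cdom.
pose f s := a (cinv (mchart_at e) s) m.
have fs0 : f s0 = m by rewrite /f s0K lie_act1.
have mf : cdom (mchart_at m) (f s0) by rewrite fs0; exact: mem_cdom.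
have [nf df] := orbit_differentiable (cmap_cod (mem_cdom e)) mf.
have dh : differentiable ((h : M -> R^o) \o cinv (mchart_at m))
    (cmap (mchart_at m) (f s0)).
  by apply: Cinf_differentiable (h_smooth m) _; split=> //; exact: cmap_cod.
have [_ E] := diff_through_chart nf df dh.
have <- : 'd (cst (h m) : _ -> R^o) s0 zeta = 0 by rewrite diff_val.
have <- : (h : M -> R^o) \o f = cst (h m) by apply/funext => s /=; rewrite h_inv.
apply: (etrans _ (esym (congr1 (@^~ zeta) E))).
rewrite /dfun /generator /tangent_map lie_act1.
exact: (congr1 (fun p => 'd ((h : M -> R^o) \o cinv (mchart_at m))
    (cmap (mchart_at m) p) ('d (cmap (mchart_at m) \o f) s0 zeta)) (esym fs0)).
Qed.

(** By equivariance [i] sends the orbit of [m] to the lifted orbit of [i m], so [noether_in_chart]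
    applies with [iota] the coordinate form of [i]. *)
Lemma diff_momentum n r (Q : manifold R n) (M : manifold R r)
    (i : M -> cotangent_bundle Q) (aQ : lie_action G Q) (aM : lie_action G M)
    (m : M) (eta : 'rV[R]_d) :
  smooth_map (X := M) setT i ->
  (forall g p, i (aM g p) = cotangent_lift aQ g (i p)) ->
  let J : 'rV[R]_r -> R^o := fun y => momentum aQ (i (cinv (mchart_at m) y)) eta in
  differentiable J (base (X := M) m) /\
  forall v, 'd J (base (X := M) m) v
    = omega_can (i m) (tangent_map (X := M) i m (generator aM m eta))
                      (tangent_map (X := M) i m v).
Proof.
move=> i_smooth aM_induced J; set x0 := base m.
pose e := gone G; pose s0 := cmap (mchart_at e) e.
have e_cdom : cdom (mchart_at e) e by exact: mem_cdom.
have s0_ccod : ccod (mchart_at e) s0 by exact: cmap_cod.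
have s0K : cinv (mchart_at e) s0 = e by exact: cmapK.
have x0K : cinv (mchart_at m) x0 = m by exact/cmapK/mem_cdom.
have x0_ccod : ccod (mchart_at m) x0 by exact/cmap_cod/mem_cdom.
(* All computations use the canonical chart preferred at [c], in which [omega_can] and the values of
   [tangent_map i m] have their components. *)
set c := i m; pose q := c.1; pose uq := cmap (mchart_at q) q.
have uqK : cinv (mchart_at q) uq = q by exact/cmapK/mem_cdom.
pose iota y := cmap (chart_at c) (i (cinv (mchart_at m) y)).
pose f s := aM (cinv (mchart_at e) s) m.
pose gamma s := cmap (chart_at c) (i (f s)).
have fs0 : f s0 = m by rewrite /f s0K lie_act1.
have qi : cdom (chart_at c) (i (cinv (chart_at m) x0)).
  by rewrite /= x0K; exact: mem_cdom.
have [ni di] := smooth_map_chart i_smooth x0_ccod qi.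
have mf : cdom (mchart_at m) (f s0) by rewrite fs0; exact: mem_cdom.
have [nf df] := orbit_differentiable s0_ccod mf.
have di' : differentiable ((cmap (chart_at c) \o i) \o cinv (mchart_at m))
    (cmap (mchart_at m) (f s0)) by rewrite fs0.
have [dgamma Egamma] := diff_through_chart nf df di'.
have iotax0 : lsubmx (iota x0) = uq by rewrite /iota x0K /= row_mxKl.
have [oB cB] := action_chart_smooth aQ e q q.
have Bz : action_chart_dom aQ e q q (row_mx s0 uq).
  by apply: action_chart_dom_one; exact: mem_cdom.
have gi : gamma s0 = iota x0 by rewrite /gamma fs0 /iota x0K.
have Aid : \near uq, action_chart aQ e q q (row_mx s0 uq) = uq.
  have : \near uq, ccod (mchart_at q) uq.
    apply: open_nbhs_nbhs; split; first exact: open_ccod.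
    exact/cmap_cod/mem_cdom.
  apply: filterS => u qu.
  by rewrite /action_chart row_mxKl row_mxKr s0K lie_act1 cinvK.
have lg : \near s0, lsubmx (gamma s0) = action_chart aQ e q q (row_mx s0 uq).
  near=> s.
  by rewrite /gamma /f aM_induced /= row_mxKl /action_chart row_mxKl row_mxKr uqK.
have pg w : exists p, \near s0, pairing (rsubmx (gamma s0))
    ('D_(row_mx 0 w) (action_chart aQ e q q) (row_mx s0 uq)) = p.
  (* By [cotangent_lift_chart] the transported covector and vector keep their initial pairing. *)
  exists (pairing c.2 w).
  have [nB _] := action_chart_comp (row_mxl_differentiable s0 uq) Bz.
  apply: filterS nB => s Bs.
  apply: (etrans (congr1 (pairing _) (action_chart_partial w Bs))).
  rewrite /gamma /f aM_induced.
  apply: cotangent_lift_chart; case: Bs => _ _.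
  by rewrite row_mxKl row_mxKr uqK.
rewrite -iotax0 in Bz Aid lg pg.
have [dJ EJ] := noether_in_chart eta oB cB Bz dgamma di gi Aid lg pg.
have JE : \near x0, pairing (rsubmx (iota x0)) ('D_(row_mx eta 0)
    (action_chart aQ e q q) (row_mx s0 (lsubmx (iota x0)))) = J x0.
  by apply: filterS ni => y [_ qy]; rewrite /J (momentum_chart _ _ (c := c)).
have [dJ' EJ'] := near_eq_is_diff dJ JE.
split; first exact: dJ'.
move=> v; apply: (etrans (congr1 (@^~ v) EJ')); apply: (etrans (EJ v)).
(* The orbit passes through the chart at [m], so its velocity factors as the generator followed by
   the tangent map of [i]. *)
have Eg : 'd gamma s0 eta = tangent_map (X := M) i m (generator aM m eta).
  apply: (etrans (congr1 (@^~ eta) Egamma)).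
  rewrite /generator /tangent_map lie_act1.
  exact: (congr1 (fun p => 'd ((cmap (chart_at c) \o i) \o cinv (mchart_at m))
    (cmap (mchart_at m) p) ('d (cmap (mchart_at m) \o f) s0 eta)) fs0).
rewrite /omega_can -Eg.
by [].
Unshelve. all: by end_near. Qed.

End Momentum.

(** * The momentum equation for a horizontal section of symmetries *)

Theorem theorem2 (R : realType) (n k r d : nat)
  (S : nonholonomic_system R n k)
  (M : manifold R r) (i : M -> cotangent_bundle (conf S))
  (i_embedding : embedding i)
  (range_i : range i = constrained_momenta S)
  (G : lie_group R d) (aQ : lie_action G (conf S))
  (distribution_invariant : forall (g : G) (b : tangent_bundle (conf S)),
     b.2 \in constraint_space b.1 ->
     (tangent_lift aQ g b).2 \in constraint_space (tangent_lift aQ g b).1)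
  (lagrangian_invariant : forall (g : G) (b : tangent_bundle (conf S)),
     lagrangian (tangent_lift aQ g b) = lagrangian b)
  (aM : lie_action G M)
  (aM_induced : forall (g : G) (m : M), i (aM g m) = cotangent_lift aQ g (i m))
  (aM_free : free_action aM) (aM_proper : proper_action aM)
  (constant_rank : exists c : nat, forall m : M,
     \dim (horizontal i m + vertical aM m)%VS = c)
  (xi : d.-tuple 'rV[R]_d) (xi_basis : basis_of fullv xi)
  (U : set M) (openU : open U)
  (f : 'I_d -> M -> R)
  (f_smooth : forall j, smooth_fun (X := M) U (f j))
  (f_section : forall m, U m ->
     \sum_(j < d) f j m *: tnth xi j \in horizontal_symmetry i aM m)
  (h : M -> R) (h_smooth : smooth_fun (X := M) setT h)
  (h_invariant : forall (g : G) (m : M), h (aM g m) = h m)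
  (X : M -> 'rV[R]_r)
  (X_solution : dirac_section i U X (fun m => covec (dfun (X := M) h m))) :
  forall m, U m ->
    dfun (X := M)
      (fun p => momentum aQ (i p) (\sum_(j < d) f j p *: tnth xi j)) m (X m)
    - \sum_(j < d) dfun (X := M) (f j) m (X m) * momentum aQ (i m) (tnth xi j)
    = 0.
Proof.
move=> m Um; set x0 := base (X := M) m; set v := X m.
have [i_smooth _ _ _] := i_embedding.
have x0K : cinv (mchart_at m) x0 = m by exact/cmapK/mem_cdom.
have x0_ccod : ccod (mchart_at m) x0 by exact/cmap_cod/mem_cdom.
(* The coefficients are frozen at [m]; their variation is carried by the functions [F j]. *)
pose eta := \sum_(j < d) f j m *: tnth xi j.
pose J zeta : 'rV[R]_r -> R^o := fun y => momentum aQ (i (cinv (mchart_at m) y)) zeta.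
pose F j : 'rV[R]_r -> R^o := f j \o cinv (mchart_at m).
have dJ zeta : differentiable (J zeta) x0.
  by have [] := diff_momentum m zeta i_smooth aM_induced.
have dF j : differentiable (F j) x0.
  by apply: Cinf_differentiable (f_smooth j m) _; split=> //; rewrite x0K.
have DJ zeta : 'D_v (J zeta) x0 = - omegaM i m v (generator aM m zeta).
  rewrite deriveE//.
  have [_ ->] := diff_momentum m zeta i_smooth aM_induced.
  exact: omega_can_anti.
have hor : generator aM m eta \in horizontal i m.
  have := f_section m Um; rewrite -memv_preim generator_lfunE memv_cap => /andP[_].
  exact.
(* The annihilator part of the Dirac condition is evaluated on the horizontal vector
   [generator aM m eta], where the differential of [h] vanishes. *)
have omegaX : omegaM i m v (generator aM m eta) = 0.
  have [_ [_ /(_ m _ Um hor)]] := X_solution.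
  rewrite pairingBl !pairing_covec; last 2 first.
  - exact: omegaM_linear.
  - by move=> *; rewrite /dfun linearP.
  by rewrite (dfun_invariant _ _ h_smooth h_invariant) sub0r => /eqP; rewrite oppr_eq0 => /eqP.
have DJeta : \sum_(j < d) f j m * 'D_v (J (tnth xi j)) x0 = 0.
  rewrite -[RHS](_ : 'D_v (J eta) x0 = 0); last by rewrite DJ omegaX oppr0.
  have -> : J eta = \sum_(j < d) (f j m *: J (tnth xi j)).
    apply/funext => y; rewrite fct_sumE; exact: momentum_sum.
  rewrite derive_sum => [|j]; last exact/diff_derivable/differentiableZ.
  by apply: eq_bigr => j _; rewrite deriveZ//; exact: diff_derivable.
have dFJ j : differentiable (F j * J (tnth xi j)) x0 by exact: differentiableM.
have -> : dfun (X := M)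
    (fun p => momentum aQ (i p) (\sum_(j < d) f j p *: tnth xi j)) m v
    = 'D_v (\sum_(j < d) F j * J (tnth xi j)) x0.
  rewrite deriveE; last exact: differentiable_sum.
  have FJE : (fun p => momentum aQ (i p) (\sum_(j < d) f j p *: tnth xi j))
      \o cinv (mchart_at m) = \sum_(j < d) F j * J (tnth xi j).
    by apply/funext => y; rewrite fct_sumE; exact: momentum_sum.
  exact: (congr1 (fun H : 'rV[R]_r -> R^o => 'd H x0 v) FJE).
rewrite derive_sum => [|j]; last exact: diff_derivable.
(* In the product rule the terms that differentiate [F j] are the subtracted ones; those that
   differentiate the momentum form the sum in [DJeta]. *)
rewrite -sumrB -[RHS]DJeta; apply: eq_bigr => j _.
rewrite deriveM; [|exact: diff_derivable..].
have -> : dfun (X := M) (f j) m v = 'D_v (F j) x0 by rewrite deriveE.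
have -> : F j x0 = f j m by rewrite /F /= x0K.
have -> : J (tnth xi j) x0 = momentum aQ (i m) (tnth xi j) by rewrite /J x0K.
by rewrite [X in _ - X]mulrC addrK.
Qed.
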